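(* Let $\varepsilon>0$ be fixed, let $n$ be a positive integer, and let $G(V,E,w)$ be a weighted graph with $\Delta(G)\ge n$. (1) Suppose that $G(V,E,w)$ is $(n,\varepsilon)$-convex and that for every $v\in V_n$, every choice of $n$ distinct vertices $u_1,\dots,u_n\in A(v)$ and every $k\in\mathbb{N}\cup\{0\}$, $$w(v)\le \frac{w_k(u_1)+\cdots+w_k(u_n)}{n}+\varepsilon ,$$ where $(w_k)_{k\ge 0}$ is the iteration of $w$ defined in the context. Then there exists a weight function $\widetilde w:V\to\mathbb{R}_+$ such that $G(V,E,\widetilde w)$ is $n$-convex and $\|w-\widetilde w\|_\infty\le \varepsilon/2$. (2) Conversely, if $\widetilde w:V\to\mathbb{R}_+$ is such that $G(V,E,\widetilde w)$ is $n$-convex and $\|w-\widetilde w\|_\infty\le\varepsilon/2$, then $G(V,E,w)$ is $(n,\varepsilon)$-convex.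
   Context: All graphs are finite, simple and connected. $\mathbb{R}_+=[0,\infty)$ and $\mathbb{N}=\{1,2,\dots\}$. A weighted graph $G(V,E,w)$ is a graph with vertex set $V$, edge set $E$ and a weight function $w:V\to\mathbb{R}_+$. $\Delta(G)$ is the maximum degree. $V_n$ denotes the set of vertices of degree at least $n$, and $A(v)$ the set of vertices adjacent to $v$. $\|f\|_\infty=\sup_{v\in V}|f(v)|$. $G(V,E,w)$ is $n$-convex if for every $v\in V_n$ and every choice of $n$ distinct vertices $v_1,\dots,v_n\in A(v)$, $n\cdot w(v)\le w(v_1)+\cdots+w(v_n)$. A weighted graph $G(V,E,w)$ with $\Delta(G)\ge n$ is $(n,\varepsilon)$-convex if for every $v\in V_n$ and every choice of $n$ distinct vertices $v_1,\dots,v_n\in A(v)$, $w(v)\le \frac{w(v_1)+\cdots+w(v_n)}{n}+\varepsilon$. The iteration of $w$ is the sequence of functions $w_k:V\to\mathbb{R}_+$ defined by $w_0=w$ and, for $k\ge 1$, $w_k(v)=w(v)$ if $v\in V\setminus V_n$, and $$w_k(v)=\min\Big\{w_{k-1}(v),\ \inf_{u_1,\dots,u_n}\frac{w_{k-1}(u_1)+\cdots+w_{k-1}(u_n)}{n}\Big\}\quad\text{if } v\in V_n,$$ the infimum being over all choices of $n$ distinct vertices $u_1,\dots,u_n\in A(v)$. *)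

(* Defs.v *)
From HB Require Import structures.
From mathcomp Require Import all_boot all_order all_algebra.
From mathcomp Require Import boolp classical_sets reals.

Set Implicit Arguments.
Unset Strict Implicit.
Unset Printing Implicit Defensive.

Import Order.TTheory GRing.Theory Num.Theory.

Record sgraph := SGraph {
  vertex :> finType;
  adj : rel vertex;
  adj_sym : symmetric adj;
  adj_irrefl : irreflexive adj;
  adj_connected : forall u v : vertex, connect adj u v }.

Definition nbhd (G : sgraph) (v : G) : {set G} := [set u | adj v u]%SET.

Definition degree (G : sgraph) (v : G) : nat := #|nbhd v|.

Definition max_degree (G : sgraph) : nat := \max_(v : G) degree v.

Definition deg_ge (G : sgraph) (n : nat) : {set G} :=
  [set v : G | n <= degree v]%SET.

(* Repetition-free n-tuples stand for choices of n distinct neighbours; the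
   order of the entries does not affect the sums below. *)
Definition nbr_choice (G : sgraph) (n : nat) (v : G) (u : n.-tuple G) : Prop :=
  uniq u /\ {subset u <= nbhd v}.

Local Open Scope classical_set_scope.
Local Open Scope ring_scope.

Definition is_weight (R : realType) (G : sgraph) (w : G -> R) : Prop :=
  forall v, 0 <= w v.

Definition avg (R : realType) (G : sgraph) (n : nat) (w : G -> R)
    (u : n.-tuple G) : R :=
  (\sum_(x <- u) w x) / n%:R.

Definition n_convex (R : realType) (G : sgraph) (n : nat) (w : G -> R) : Prop :=
  forall (v : G) (u : n.-tuple G), v \in deg_ge G n -> nbr_choice v u ->
    n%:R * w v <= \sum_(x <- u) w x.

Definition n_eps_convex (R : realType) (G : sgraph) (n : nat) (eps : R)
    (w : G -> R) : Prop :=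
  forall (v : G) (u : n.-tuple G), v \in deg_ge G n -> nbr_choice v u ->
    w v <= avg w u + eps.

(* For v in [deg_ge G n] and nonnegative w, the set below is nonempty and
   bounded below, so [inf] is its true infimum. *)
Fixpoint iteration (R : realType) (G : sgraph) (n : nat) (w : G -> R) (k : nat)
    : G -> R :=
  if k is k'.+1 then
    fun v => if v \in deg_ge G n then
               Num.min (iteration n w k' v)
                 (inf [set avg (iteration n w k') u
                      | u in [set u : n.-tuple G | nbr_choice v u]])
             else w v
  else w.

(* [sup] is the true supremum as soon as G has a vertex, e.g. when
   [0 < max_degree G]; over the empty graph its value is 0. *)
Definition norm_inf (R : realType) (G : sgraph) (f : G -> R) : R :=
  sup (range (fun v => `|f v|)).

(* Main.v *)
Require Import Defs.
From mathcomp Require Import all_boot all_order all_algebra.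
From mathcomp Require Import boolp classical_sets reals.
From mathcomp Require Import lra.
Import Order.TTheory GRing.Theory Num.Theory.
Local Open Scope ring_scope.

(** The iteration [w_0 >= w_1 >= ...] is nonincreasing and nonnegative, so it
    has a pointwise limit [W], which is also its pointwise infimum.  Every step
    forces [w_k.+1 v] below the averages of [w_k] over [n] neighbours of [v];
    passing to the limit, [W] is [n]-convex ([n_convex_iteration_inf]).  Trivially
    [W <= w], and the hypothesis of part (1) says precisely that no step of the
    iteration can push a value more than [eps] below [w]
    ([iteration_ge_sub_eps]), so [w - eps <= W <= w].  Since [n]-convexity is
    unaffected by adding a constant, [W + eps / 2] is [n]-convex, and it lies
    within [eps / 2] of [w].

    Conversely, if [wt] is [n]-convex and within [eps / 2] of [w], replacing
    [w v] by [wt v] and then the average of [wt] by that of [w] costs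
    [eps / 2] each time. *)

Section Average.
Context {R : realType} {G : sgraph} {n : nat}.
Implicit Types (f g : G -> R) (u : n.-tuple G).

Lemma avg_ge0 f u : is_weight f -> 0 <= avg f u.
Proof. by move=> f0; rewrite divr_ge0 // sumr_ge0. Qed.

Lemma avg_le f g u : (forall x, f x <= g x) -> avg f u <= avg g u.
Proof. by move=> fg; rewrite ler_wpM2r ?invr_ge0 // ler_sum. Qed.

Lemma avg_addc f (c : R) u :
  (0 < n)%N -> avg (fun x => f x + c) u = avg f u + c.
Proof.
move=> n0; rewrite /avg big_split /= mulrDl; congr (_ + _).
rewrite big_const_seq count_predT size_tuple iter_addr_0 -(mulr_natr c) mulfK //.
by rewrite pnatr_eq0 -lt0n.
Qed.

Lemma n_convex_avg f :
  (0 < n)%N ->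
  n_convex n f <-> (forall (v : G) u, v \in deg_ge G n -> nbr_choice v u ->
    f v <= avg f u).
Proof.
move=> n0; have n0R : 0 < n%:R :> R by rewrite ltr0n.
by split=> fc v u vn uv; have := fc v u vn uv;
  rewrite /avg ler_pdivlMr // mulrC.
Qed.

Lemma n_convex_addc f (c : R) :
  (0 < n)%N -> n_convex n f -> n_convex n (fun x => f x + c).
Proof.
move=> n0 /(n_convex_avg f n0) fc; apply/n_convex_avg => // v u vn uv.
by rewrite avg_addc // lerD2r fc.
Qed.

Lemma nbr_choice_exists (v : G) :
  v \in deg_ge G n -> exists u : n.-tuple G, nbr_choice v u.
Proof.
rewrite inE => vn.
have sz : size (take n (enum (nbhd v))) == n.
  by rewrite size_takel // -cardE.
exists (Tuple sz); split=> /=; first by rewrite take_uniq // enum_uniq.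
by move=> x /mem_take; rewrite mem_enum.
Qed.

End Average.

Section NormInf.
Context {R : realType} {G : sgraph}.
Implicit Type f : G -> R.

Lemma le_norm_inf f v : `|f v| <= norm_inf f.
Proof.
apply: ub_le_sup; last by exists v.
(* Over a finite vertex set, the sum of all |f x| bounds each of them. *)
exists (\sum_x `|f x|) => _ [x _ <-].
by rewrite (bigD1 x) //= lerDl sumr_ge0.
Qed.

Lemma norm_inf_le f (c : R) :
  0 <= c -> (forall v, `|f v| <= c) -> norm_inf f <= c.
Proof.
move=> c0 fc; rewrite /norm_inf.
have [->|/set0P ne] := eqVneq (range (fun v => `|f v|)) set0; first by rewrite sup0.
by apply: ge_sup => // _ [v _ <-].
Qed.

End NormInf.

Section Iteration.
Context {R : realType} {G : sgraph} (n : nat) (w : G -> R).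
Hypothesis w0 : is_weight w.

Lemma iteration_ge0 k : is_weight (iteration n w k).
Proof.
elim: k => //= k IH v; case: ifP => // vn.
have [u0 u0P] := nbr_choice_exists v vn.
rewrite le_min IH /=; apply: lb_le_inf; first by exists (avg (iteration n w k) u0), u0.
by move=> _ [u _ <-]; exact: avg_ge0.
Qed.

Lemma iterationS_le k v : iteration n w k.+1 v <= iteration n w k v.
Proof.
have [vn|vn] := boolP (v \in deg_ge G n); first by rewrite /= vn ge_min lexx.
by case: k => [|k] /=; rewrite (negbTE vn).
Qed.

Lemma iteration_nonincreasing k l v :
  (k <= l)%N -> iteration n w l v <= iteration n w k v.
Proof.
move/subnKC <-; elim: (l - k)%N => [|m IH]; first by rewrite addn0.
by rewrite addnS (le_trans (iterationS_le _ _)).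
Qed.

Lemma iterationS_le_avg k (v : G) (u : n.-tuple G) :
  v \in deg_ge G n -> nbr_choice v u ->
  iteration n w k.+1 v <= avg (iteration n w k) u.
Proof.
move=> vn uv /=; rewrite vn ge_min; apply/orP; right.
apply: ge_inf; last by exists u.
by exists 0 => _ [u' _ <-]; apply: avg_ge0; exact: iteration_ge0.
Qed.

(** A step either keeps the previous value or replaces it by an infimum of
    averages of the current iterate, each of which is at least [w v - eps] by
    hypothesis. *)
Lemma iteration_ge_sub_eps (eps : R) :
  0 <= eps ->
  (forall (v : G) (u : n.-tuple G) (k : nat),
     v \in deg_ge G n -> nbr_choice v u ->
     w v <= avg (iteration n w k) u + eps) ->
  forall k v, w v - eps <= iteration n w k v.
Proof.
move=> e0 H; elim=> [|k IH] v /=; first by rewrite gerBl.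
case: ifP => vn; last by rewrite gerBl.
have [u0 u0P] := nbr_choice_exists v vn.
rewrite le_min IH /=; apply: lb_le_inf; first by exists (avg (iteration n w k) u0), u0.
by move=> _ [u uv <-]; rewrite lerBlDr H.
Qed.

Definition iteration_inf (v : G) : R :=
  inf (range (fun k => iteration n w k v)).

Lemma iteration_inf_le k v : iteration_inf v <= iteration n w k v.
Proof.
apply: ge_inf; last by exists k.
by exists 0 => _ [l _ <-]; exact: iteration_ge0.
Qed.

Lemma le_iteration_inf (c : R) v :
  (forall k, c <= iteration n w k v) -> c <= iteration_inf v.
Proof.
move=> H; apply: lb_le_inf; first by exists (iteration n w 0 v), 0%N.
by move=> _ [k _ <-].
Qed.

(** On a finite vertex set the monotone convergence to the infimum is
    uniform: take the largest of the ranks that work at each vertex. *)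
Lemma iteration_inf_uniform (d : R) :
  0 < d -> exists k, forall v, iteration n w k v <= iteration_inf v + d.
Proof.
move=> d0.
have /choice[K KP] : forall v, exists k, iteration n w k v <= iteration_inf v + d.
  move=> v; have [|_ [k _ <-] /ltW kP] := @inf_adherent _ (range (fun k => iteration n w k v)) d d0.
    split; first by exists (iteration n w 0 v), 0%N.
    by exists 0 => _ [l _ <-]; exact: iteration_ge0.
  by exists k.
exists (\max_v K v)%N => v; apply: le_trans (KP v).
by apply: iteration_nonincreasing; exact: leq_bigmax.
Qed.

Lemma n_convex_iteration_inf : (0 < n)%N -> n_convex n iteration_inf.
Proof.
move=> n0; apply/n_convex_avg => // v u vn uv.
apply/ler_addgt0Pr => d /iteration_inf_uniform[k kP].
rewrite -avg_addc // (le_trans (iteration_inf_le k.+1 v)) //.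
by rewrite (le_trans (iterationS_le_avg k v u vn uv)) // avg_le.
Qed.

End Iteration.

Theorem theorem1p7 (R : realType) (eps : R) (n : nat) (G : sgraph) (w : G -> R)
    (heps : 0 < eps) (hn : (0 < n)%N) (hw : is_weight w)
    (hG : (n <= max_degree G)%N) :
  (n_eps_convex n eps w ->
   (forall (v : G) (u : n.-tuple G) (k : nat),
      v \in deg_ge G n -> nbr_choice v u ->
      w v <= avg (iteration n w k) u + eps) ->
   exists wt : G -> R,
     [/\ is_weight wt, n_convex n wt &
         norm_inf (fun v => w v - wt v) <= eps / 2])
  /\
  (forall wt : G -> R,
     is_weight wt -> n_convex n wt ->
     norm_inf (fun v => w v - wt v) <= eps / 2 ->
     n_eps_convex n eps w).
Proof.
split=> [_ H|wt _ wtc wt_near v u vn uv].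
  exists (fun v => iteration_inf n w v + eps / 2); split.
  - move=> v; have : 0 <= iteration_inf n w v.
      by apply: le_iteration_inf => k; exact: iteration_ge0.
    lra.
  - by apply: n_convex_addc => //; exact: n_convex_iteration_inf.
  - apply: norm_inf_le => [|v]; first lra.
    have Wle : iteration_inf n w v <= w v := iteration_inf_le n w hw 0 v.
    have leW : w v - eps <= iteration_inf n w v.
      apply: le_iteration_inf => k.
      by apply: iteration_ge_sub_eps => //; exact: ltW.
    rewrite ler_norml; lra.
have near x : `|w x - wt x| <= eps / 2.
  exact: le_trans (le_norm_inf (fun x => w x - wt x) x) wt_near.
have wtv : wt v <= avg wt u by move/n_convex_avg: wtc; apply.
have avg_near : avg wt u <= avg w u + eps / 2.
  rewrite -avg_addc //; apply: avg_le => x.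
  by have := near x; rewrite ler_norml; lra.
by have := near v; rewrite ler_norml; lra.
Qed.
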